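(* For every integer $n\ge 1$, the number of ordered set partitions of $[n]$ into exactly $n-1$ blocks that avoid the pattern $123$ is $$\operatorname{op}_{n,n-1}(123) = \frac{3(n-1)^2\binom{2n-2}{n-1}}{n(n+1)}.$$
   Context: An ordered set partition of $[n]$ into $k$ blocks is a sequence $B_1/B_2/\cdots/B_k$ of nonempty, pairwise disjoint subsets of $[n]$ whose union is $[n]$; the order of the blocks matters, but not the order of elements within a block. For a permutation $\rho=\rho_1\cdots\rho_m\in\mathcal{S}_m$, an ordered partition $B_1/\cdots/B_k$ contains $\rho$ if there are block indices $i_1<i_2<\cdots<i_m$ and elements $b_j\in B_{i_j}$ such that $b_1\cdots b_m$ is order-isomorphic to $\rho$ (i.e. $b_a<b_c$ iff $\rho_a<\rho_c$); otherwise it avoids $\rho$. $\operatorname{op}_{n,k}(\rho)$ denotes the number of ordered partitions of $[n]$ into $k$ blocks that avoid $\rho$ (so it is $0$ when $k=0<n$). *)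

(* Defs.v *)
From mathcomp Require Import all_boot all_order all_algebra all_fingroup.
Set Implicit Arguments. Unset Strict Implicit. Unset Printing Implicit Defensive.

(* [n] = {1,...,n} is modelled by 'I_n = {0,...,n-1} (an order isomorphism,
   irrelevant for pattern avoidance). An ordered set partition into k blocks
   is the sequence of blocks B_0/.../B_(k-1), i.e. a function 'I_k -> {set 'I_n}. *)
Definition is_ordered_partition (n k : nat) (B : {ffun 'I_k -> {set 'I_n}}) : bool :=
  [&& [forall i : 'I_k, B i != set0],
      [forall i : 'I_k, forall j : 'I_k, (i != j) ==> [disjoint B i & B j]] &
      (\bigcup_(i < k) B i == [set: 'I_n])].

Definition contains_pattern (n k m : nat) (B : {ffun 'I_k -> {set 'I_n}})
    (rho : 'S_m) : bool :=
  [exists idx : {ffun 'I_m -> 'I_k}, exists b : {ffun 'I_m -> 'I_n},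
    [&& [forall a : 'I_m, forall c : 'I_m, (a < c)%N ==> (idx a < idx c)%N],
        [forall a : 'I_m, b a \in B (idx a)] &
        [forall a : 'I_m, forall c : 'I_m,
           ((b a < b c)%N == (rho a < rho c)%N)]]].

Definition avoids_pattern (n k m : nat) (B : {ffun 'I_k -> {set 'I_n}})
    (rho : 'S_m) : bool := ~~ contains_pattern B rho.

Definition op (n k m : nat) (rho : 'S_m) : nat :=
  #|[set B : {ffun 'I_k -> {set 'I_n}} |
      is_ordered_partition B && avoids_pattern B rho]|.

Definition pat123 : 'S_3 := 1%g.

(* Main.v *)
Require Import Defs.
From mathcomp Require Import all_boot all_order all_algebra all_fingroup.
From mathcomp Require Import zify ring lra.
Set Implicit Arguments. Unset Strict Implicit. Unset Printing Implicit Defensive.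
Import GRing.Theory.

(** Recording, for each element, the index of its block turns an ordered
    partition of [n] into k blocks into a word of length n whose letter set is
    {0,...,k-1}; the partition avoids 123 iff the word has no strictly
    increasing subsequence of length 3.  Such words are grown by prepending
    letters, either new (the larger letters being shifted up) or repeated.  The
    admissible letters depend only on the number m of letters and on
    t = 1 + the largest letter that starts an ascending pair (0 if there is
    none).  When k = n - 1, exactly one letter is repeated.  After the
    repetition one follows the Catalan tree, where a node labelled
    l = m + 1 - t has children labelled 2,...,l+1; before it one counts the
    places where the repetition can occur.  Both recurrences are solved in terms
    of the numbers 'C(2r + s, r), the coefficients of C(x)^s / sqrt(1 - 4x) with
    C(x) the Catalan series. *)

(** * Avoidance of 123, read off letter by letter *)

(* One more than the largest letter of [s] that is followed by a larger one. *)
Fixpoint low (s : seq nat) : nat :=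
  if s is v :: s' then
    if has (ltn v) s' then maxn v.+1 (low s') else low s'
  else 0.

(** A leading [v] completes a 123 exactly when an ascending pair of [s'] starts above [v], that is,
    when [v.+1 < low s']. *)
Fixpoint avoids123 (s : seq nat) : bool :=
  if s is v :: s' then (low s' <= v.+1) && avoids123 s' else true.

Lemma lowP (s : seq nat) (y : nat) :
  reflect (exists i j, [/\ i < j, j < size s, y <= nth 0 s i
                         & nth 0 s i < nth 0 s j]) (y < low s).
Proof.
elim: s => [|v s IHs] /=; first by apply: ReflectF => -[i [j []]].
apply: (iffP idP).
  have tl : y < low s -> exists i j, [/\ i < j, j < (size s).+1,
      y <= nth 0 (v :: s) i & nth 0 (v :: s) i < nth 0 (v :: s) j].
    by case/IHs=> i [j [ij js yi lt_ij]]; exists i.+1, j.+1.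
  case: ifP => // /hasP [x xs /= vx]; rewrite leq_max => /orP [yv|//].
  by exists 0, (index x s).+1; split; rewrite /= ?nth_index // ltnS index_mem.
case=> -[|i] [[|j] []] //= ij js yi lt_ij.
  have -> : has (ltn v) s by apply/hasP; exists (nth 0 s j); rewrite ?mem_nth.
  by rewrite leq_max ltnS yi.
have ys : y < low s by apply/IHs; exists i, j.
by case: ifP => // _; rewrite leq_max ys orbT.
Qed.

Lemma avoids123PN (s : seq nat) :
  reflect (exists i j k, [/\ i < j, j < k, k < size s,
             nth 0 s i < nth 0 s j & nth 0 s j < nth 0 s k])
    (~~ avoids123 s).
Proof.
elim: s => [|v s IHs] /=; first by apply: ReflectF => -[i [j [k []]]].
rewrite negb_and -ltnNge; apply: (iffP orP).
  case=> [/lowP [j [k [jk ks vj lt_jk]]]|/IHs [i [j [k [ij jk ks h1 h2]]]]].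
    by exists 0, j.+1, k.+1.
  by exists i.+1, j.+1, k.+1.
case=> -[|i] [[|j] [[|k] []]] //= ij jk ks h1 h2.
  by left; apply/lowP; exists j, k.
by right; apply/IHs; exists i, j, k.
Qed.

(** A nonzero [low] is one more than a letter, so the threshold moves to [v.+1]; the default 0 stays
    below it. *)
Lemma low_map_bump (v : nat) (s : seq nat) :
  low (map (bump v) s) = bump v.+1 (low s).
Proof.
elim: s => [|x s IHs] //=; rewrite has_map IHs.
rewrite (@eq_has _ _ (ltn x)); last by move=> y /=; rewrite /bump; lia.
by case: ifP => // _; rewrite /bump; lia.
Qed.

Lemma avoids123_map_bump (v : nat) (s : seq nat) :
  avoids123 (map (bump v) s) = avoids123 s.
Proof.
elim: s => [|x s IHs] //=; rewrite IHs low_map_bump; congr (_ && _).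
by rewrite /bump; lia.
Qed.

Lemma has_ltn_iota (m v : nat) (s : seq nat) :
  s =i iota 0 m -> has (ltn v) s = (v < m.-1).
Proof.
move=> s_m; apply/hasP/idP => [[x]|v_m].
  by rewrite s_m mem_iota /=; lia.
by exists m.-1 => //; rewrite s_m mem_iota; lia.
Qed.

Lemma low_le (m : nat) (s : seq nat) : s =i iota 0 m -> low s <= m.-1.
Proof.
move=> s_m; rewrite leqNgt; apply/lowP=> -[i [j [_ js mi ij]]].
have := mem_nth 0 js; rewrite s_m mem_iota /=.
move: mi ij; set x := nth 0 s i; set z := nth 0 s j; lia.
Qed.

(** * Generation of the avoiding words by prepending letters *)

(* The bound on the first letter is [low s <= v.+1] for a repeated letter [v];
   for a new letter it becomes [low s <= v], since [bump v] shifts [low s]. *)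
Fixpoint words (L m : nat) : seq (seq nat) :=
  match L, m with
  | 0, 0 => [:: [::]]
  | 0, _.+1 => [::]
  | L'.+1, 0 => [::]
  | L'.+1, m'.+1 =>
      [seq v :: s | s <- words L' m'.+1, v <- index_iota (low s).-1 m'.+1] ++
      [seq v :: map (bump v) s | s <- words L' m', v <- index_iota (low s) m'.+1]
  end.

Lemma mem_bump_iota (m v : nat) (s : seq nat) : v <= m ->
  (v :: map (bump v) s =i iota 0 m.+1) <-> (s =i iota 0 m).
Proof.
move=> vm; split=> h x.
  have := h (bump v x); rewrite !mem_iota inE eq_sym (negPf (neq_bump v x)) orFb.
  by rewrite (mem_map (can_inj (bumpK v))) => ->; rewrite /bump; lia.
rewrite mem_iota inE; case: (eqVneq x v) => [->|xv].
  by rewrite orTb; lia.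
have <- : bump v (unbump v x) = x by apply: unbumpK; rewrite inE.
rewrite orFb (mem_map (can_inj (bumpK v))) h mem_iota.
by move: xv; rewrite /bump /unbump; lia.
Qed.

Lemma mem_words (L m : nat) (s : seq nat) :
  reflect [/\ size s = L, s =i iota 0 m & avoids123 s] (s \in words L m).
Proof.
elim: L m s => [|L IHL] [|m] s.
- rewrite /= inE; apply: (iffP eqP) => [-> //|[]].
  by case: s.
- apply: ReflectF => -[/size0nil -> h _].
  by have := h 0; rewrite mem_iota.
- apply: ReflectF => -[]; case: s => // x s _ h _.
  by have := h x; rewrite inE eqxx.
rewrite [words _ _]/= mem_cat; apply: (iffP orP).
  case=> /allpairsPdep [u [v []]] /IHL [Lu u_m u_av]; rewrite mem_index_iota.
    case/andP=> v1 v2 ->; split; first by rewrite /= Lu.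
      move=> x; rewrite in_cons u_m mem_iota; case: eqP => [->|//]; lia.
    by rewrite /= u_av andbT; lia.
  case/andP=> v1 v2 ->; split; first by rewrite /= size_map Lu.
    by apply/mem_bump_iota.
  by rewrite /= avoids123_map_bump u_av low_map_bump /bump; lia.
case: s => [[]//|v s] [[Ls] s_m /= /andP [v_low s_av]].
have vm : v < m.+1 by have := s_m v; rewrite mem_iota inE eqxx; lia.
(* The first letter is a repetition iff it occurs in the tail; otherwise the tail misses [v], and
   [unbump v] closes the gap. *)
have [v_s|v_s] := boolP (v \in s).
  left; apply/allpairsPdep; exists s, v; split=> //.
    apply/IHL; split=> // x; rewrite -s_m inE.
    by case: eqP => [->|].
  by rewrite mem_index_iota; lia.
have [u Es] : exists u, s = map (bump v) u.
  exists (map (unbump v) s).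
  rewrite -map_comp -[LHS]map_id; apply/eq_in_map => x x_s /=.
  by rewrite unbumpK // inE; apply: contraNneq v_s => <-.
move: Ls s_m v_low s_av; rewrite {v_s}Es size_map avoids123_map_bump.
rewrite low_map_bump => Lu /(mem_bump_iota _ (vm : v <= m)) u_m v_low u_av.
right; apply/allpairsPdep; exists u, v; split=> //; first exact/IHL.
by rewrite mem_index_iota; move: v_low; rewrite /bump; lia.
Qed.

(** The two families are disjoint: a repeated [v] occurs in the tail, whereas [bump v] never takes
    the value [v]. *)
Lemma words_uniq (L m : nat) : uniq (words L m).
Proof.
elim: L m => [|L IHL] [|m] //; rewrite [words _ _]/= cat_uniq.
apply/and3P; split.
- apply: allpairs_uniq_dep => // [s _|]; first exact: iota_uniq.
  by move=> [s v] [s' v'] _ _ /= [-> ->].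
- apply/hasPn=> u /allpairsPdep [s [v [_ _ ->]]] /=.
  apply/allpairsPdep=> -[s' [v' [s'_w v'_m [Ev Es]]]].
  have : v' \in s'.
    by case/mem_words: s'_w => _ -> _; move: v'_m; rewrite mem_index_iota mem_iota; lia.
  by rewrite -Es -Ev => /mapP [x _ /eqP]; rewrite (negPf (neq_bump v x)).
- apply: allpairs_uniq_dep => // [s _|]; first exact: iota_uniq.
  move=> [s v] [s' v'] _ _ /= [<-] /(inj_map (can_inj (bumpK v))) -> //.
Qed.

Lemma words_gt (L m : nat) : L < m -> words L m = [::].
Proof.
elim: L m => [|L IHL] [|m] // Lm /=.
by rewrite (IHL m.+1) ?(IHL m) //; lia.
Qed.

(** * Ordered partitions as words *)

Definition blocks (n k : nat) (s : seq nat) : {ffun 'I_k -> {set 'I_n}} :=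
  [ffun i : 'I_k => [set x : 'I_n | nth 0 s x == i]].

Lemma mem_blocks (n k : nat) (s : seq nat) (i : 'I_k) (x : 'I_n) :
  (x \in blocks n k s i) = (nth 0 s x == i).
Proof. by rewrite ffunE inE. Qed.

Lemma nth_lt (k : nat) (s : seq nat) (i : nat) :
  s =i iota 0 k -> i < size s -> nth 0 s i < k.
Proof. by move=> s_k /(mem_nth 0); rewrite s_k mem_iota. Qed.

Lemma blocks_inj (n k : nat) : {in words n k &, injective (blocks n k)}.
Proof.
move=> s s' /mem_words [sn s_k _] /mem_words [s'n _ _] /ffunP Ess.
apply: (@eq_from_nth _ 0) => [|i si]; first by rewrite sn s'n.
have i_n : i < n by rewrite -sn.
have := Ess (Ordinal (nth_lt s_k si)) => /setP /(_ (Ordinal i_n)).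
by rewrite !mem_blocks /= eqxx => /esym /eqP.
Qed.

Lemma blocks_ordered_partition (n k : nat) (s : seq nat) :
  size s = n -> s =i iota 0 k -> is_ordered_partition (blocks n k s).
Proof.
move=> sn s_k; apply/and3P; split.
- apply/forallP=> i; apply/set0Pn.
  have i_s : (i : nat) \in s by rewrite s_k mem_iota /= ltn_ord.
  have i_n : index (i : nat) s < n by rewrite -sn index_mem.
  by exists (Ordinal i_n); rewrite mem_blocks /= nth_index.
- apply/'forall_forallP=> i j; apply/implyP=> ij.
  rewrite disjoint_subset; apply/subsetP=> x; rewrite inE !mem_blocks.
  by move/eqP=> ->; apply: contra_neqN ij => /eqP /val_inj.
- apply/eqP/setP=> x; rewrite inE; apply/bigcupP.
  have xs : x < size s by rewrite sn.
  by exists (Ordinal (nth_lt s_k xs)); rewrite // mem_blocks.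
Qed.

(** Elements are positions and block indices are letters; in a copy of the identity pattern both
    increase. *)
Lemma avoids_blocks (n k : nat) (s : seq nat) :
  size s = n -> s =i iota 0 k ->
  avoids_pattern (blocks n k s) pat123 = avoids123 s.
Proof.
move=> sn s_k; rewrite /avoids_pattern -[RHS]negbK; congr (~~ _).
apply/existsP/avoids123PN.
  case=> idx /existsP [b /and3P [/'forall_forallP idx_lt /forallP b_idx
                                 /'forall_forallP b_lt]].
  pose o (i : nat) : 'I_3 := inord i.
  have oE i : i < 3 -> o i = i :> nat by move=> i3; rewrite inordK.
  have lt_o i j : i < j -> j < 3 -> (b (o i) < b (o j)) /\ (idx (o i) < idx (o j)).
    move=> ij j3; have i3 := ltn_trans ij j3.
    have := idx_lt (o i) (o j); have /eqP := b_lt (o i) (o j).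
    by rewrite /pat123 !perm1 !oE // ij => -> /= ->.
  have wE i : nth 0 s (b (o i)) = idx (o i).
    by apply/eqP; have := b_idx (o i); rewrite mem_blocks.
  exists (b (o 0)), (b (o 1)), (b (o 2)); rewrite !wE sn.
  have [h1 h2] := lt_o 0 1 isT isT; have [h3 h4] := lt_o 1 2 isT isT.
  by split.
case=> [x [y [z [xy yz zs sxy syz]]]].
have ys := ltn_trans yz zs; have xs := ltn_trans xy ys.
have ord_s t : t < size s -> {u : 'I_n | u = t :> nat}.
  by rewrite sn => tn; exists (Ordinal tn).
have ord_k t : t < size s -> {i : 'I_k | i = nth 0 s t :> nat}.
  by move=> ts; exists (Ordinal (nth_lt s_k ts)).
have [[[x' Ex] [y' Ey]] [z' Ez]] := (ord_s x xs, ord_s y ys, ord_s z zs).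
have [[[i Ei] [j Ej]] [l El]] := (ord_k x xs, ord_k y ys, ord_k z zs).
pose idx : {ffun 'I_3 -> 'I_k} := [ffun a => tnth [tuple i; j; l] a].
pose b : {ffun 'I_3 -> 'I_n} := [ffun a => tnth [tuple x'; y'; z'] a].
exists idx; apply/existsP; exists b; apply/and3P; split.
- apply/'forall_forallP=> a c; rewrite !ffunE !(tnth_nth i).
  by case: a c => [[|[|[|//]]] ?] [[|[|[|//]]] ?] //=; rewrite ?Ei ?Ej ?El; lia.
- apply/forallP=> a; rewrite mem_blocks !ffunE !(tnth_nth i) !(tnth_nth x').
  by case: a => [[|[|[|//]]] ?] //=; rewrite ?Ex ?Ey ?Ez ?Ei ?Ej ?El.
- apply/'forall_forallP=> a c; rewrite !ffunE !perm1 !(tnth_nth x').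
  by case: a c => [[|[|[|//]]] ?] [[|[|[|//]]] ?] //=; rewrite ?Ex ?Ey ?Ez; lia.
Qed.

Lemma ordered_partition_blocks (n k : nat) (B : {ffun 'I_k -> {set 'I_n}}) :
  is_ordered_partition B ->
  exists s, [/\ size s = n, s =i iota 0 k & B = blocks n k s].
Proof.
case/and3P=> /forallP B_n0 /'forall_forallP B_disj /eqP B_cover.
have /fin_all_exists [w wB] (x : 'I_n) : exists i, x \in B i.
  by have /bigcupP [i _ xi] : x \in \bigcup_(i < k) B i; [rewrite B_cover inE|exists i].
have wP x i : x \in B i -> w x = i.
  move=> xi; apply/eqP; apply: contraTT isT => wi.
  have := implyP (B_disj (w x) i) wi => /pred0P /(_ x) /=.
  by rewrite wB xi.
pose s := [seq val (w x) | x <- enum 'I_n].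
have nth_s (x : 'I_n) : nth 0 s x = w x.
  by rewrite (nth_map x) ?nth_ord_enum // size_enum_ord.
exists s; split.
- by rewrite size_map size_enum_ord.
- move=> i; rewrite mem_iota; apply/mapP/idP => [[x _ ->]|/= ik].
    exact: ltn_ord.
  have /set0Pn [x xi] := B_n0 (Ordinal ik).
  by exists x; rewrite ?mem_enum // (wP _ _ xi).
- apply/ffunP=> i; apply/setP=> x; rewrite mem_blocks nth_s.
  apply/idP/eqP => [/wP -> //|/val_inj <-]; exact: wB.
Qed.

Lemma op_words (n k : nat) : op n k pat123 = size (words n k).
Proof.
rewrite -(size_map (blocks n k)) /op.
rewrite -(card_uniqP _); last first.
  by rewrite (map_inj_in_uniq (@blocks_inj n k)) words_uniq.
apply: eq_card => B; rewrite inE; apply/andP/mapP.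
  case=> /ordered_partition_blocks [s [sn s_k ->]].
  rewrite avoids_blocks // => s_av; exists s => //.
  exact/mem_words.
case=> s /mem_words [sn s_k s_av] ->; rewrite avoids_blocks //.
by split=> //; apply: blocks_ordered_partition.
Qed.

(** * Binomial identities and the Catalan tree *)

Local Open Scope ring_scope.

Definition cbin (r k : nat) : rat := 'C(2 * r + k, r)%:R.

Lemma cbinS (r k : nat) : cbin r.+1 k.+1 = cbin r.+1 k + cbin r k.+2.
Proof.
rewrite /cbin -natrD; congr (_%:R).
have -> : (2 * r.+1 + k.+1 = (2 * r.+1 + k).+1)%N by lia.
have -> : (2 * r + k.+2 = 2 * r.+1 + k)%N by lia.
by rewrite binS.
Qed.

Lemma cbinS0 (r : nat) : cbin r.+1 0 = 2 * cbin r 1.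
Proof.
rewrite /cbin -(natrM _ 2%N); congr (_%:R).
have -> : (2 * r.+1 + 0 = (2 * r + 1).+1)%N by lia.
have r_le : (r <= 2 * r + 1)%N by lia.
(* The two Pascal terms agree by symmetry of the odd row. *)
rewrite binS -(bin_sub r_le).
have -> : (2 * r + 1 - r = r.+1)%N by lia.
by rewrite addnn -mul2n.
Qed.

(* Number of nodes at depth [r] below a node labelled [k] of the Catalan tree. *)
Fixpoint tree (r k : nat) : rat :=
  if r is r'.+1 then \sum_(2 <= j < k.+2) tree r' j else 1.

Lemma treeS (r k : nat) : tree r.+1 k.+1 = tree r.+1 k + tree r k.+2.
Proof. by rewrite /= big_nat_recr. Qed.

Arguments tree : simpl never.

Lemma tree0 (r : nat) : tree r.+1 0 = 0.
Proof. by rewrite /tree big_geq. Qed.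

(** A ballot number: both binomials lie in row [2 * r + k + 2]. By Pascal's rule the difference
    satisfies [treeS]; [cbinS0] handles [k = 0]. *)
Lemma treeE (r k : nat) : tree r.+1 k.+1 = cbin r.+1 k - cbin r k.+2.
Proof.
elim: r k => [|r IHr]; elim=> [|k IHk]; rewrite treeS ?tree0 ?IHk.
- by rewrite /tree /cbin.
- by rewrite cbinS /cbin /tree !bin0 /=; ring.
- by rewrite IHr cbinS0 (cbinS r 1); ring.
- by rewrite IHr !cbinS; ring.
Qed.

(* Coefficient of x^(r+1) in the solution of the recurrence for [dups], at the
   label [k.+1] of a word having an ascending pair. *)
Definition dup_closed (r k : nat) : rat :=
  k.+1%:R * (2 * cbin r k.+1 - cbin r k) + tree r k.+1 - tree r k.+2.

(** The two subtracted trees are what [old_step_tree] contributes for [t > 0], so they cancel in the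
    recurrence for [dups]. *)
Lemma sum_dup_closed (r k : nat) :
  \sum_(1 <= j < k.+2) dup_closed r j = dup_closed r.+1 k - tree r.+1 k.+1 - tree r.+2 k.
Proof.
elim: k => [|k IHk].
  rewrite big_nat1 tree0 /dup_closed.
  have := treeS r 0; have := treeS r 1; have := treeE r 0.
  have := cbinS r 0; have := cbinS0 r; rewrite tree0.
  lra.
rewrite big_nat_recr //= IHk /dup_closed (treeS r.+1 k) (treeS r k.+1) (treeS r k.+2).
have := treeE r k; have := treeE r k.+1.
rewrite !cbinS (treeS r k.+1) (treeS r k).
have -> : k.+3%:R = k%:R + 3 :> rat by rewrite -(natrD _ k 3) addn3.
have -> : k.+2%:R = k%:R + 2 :> rat by rewrite -(natrD _ k 2) addn2.
have -> : k.+1%:R = k%:R + 1 :> rat by rewrite natr1.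
move: (k%:R : rat) (tree r.+2 k) (tree r.+1 k) => x t u.
lra.
Qed.

(** * Recurrences in the number of letters and [low] *)

Definition wsum (L m : nat) (g : nat -> rat) : rat :=
  \sum_(s <- words L m) g (low s).

(** An admissible [v] makes [low] equal to [v.+1], except that the largest letter starts no
    ascending pair and leaves [t]. *)
Definition new_step (m : nat) (g : nat -> rat) (t : nat) : rat :=
  \sum_(t <= v < m.+1) g (if (v < m)%N then v.+1 else t).

Definition old_step (m : nat) (g : nat -> rat) (t : nat) : rat :=
  \sum_(t.-1 <= v < m) g (if (v < m.-1)%N then v.+1 else t).

Lemma wsumS (L m : nat) (g : nat -> rat) :
  wsum L.+1 m.+1 g = wsum L m.+1 (old_step m.+1 g) + wsum L m (new_step m g).
Proof.
rewrite /wsum [words _.+1 _]/= big_cat !big_allpairs_dep; congr (_ + _).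
  apply: eq_big_seq => s /mem_words [_ s_m _]; apply: eq_big_nat => v v_m.
  rewrite [low _]/= (has_ltn_iota v s_m); case: ifP => // _.
  by congr g; lia.
apply: eq_big_seq => s /mem_words [_ s_m _]; apply: eq_big_nat => v v_m.
have v_le : (v <= m)%N by lia.
rewrite [low _]/= has_map low_map_bump.
rewrite (@eq_has _ _ (leq v)); last by move=> y /=; rewrite /bump; lia.
have -> : has (leq v) s = (v < m)%N.
  apply/hasP/idP => [[x]|lt_vm]; first by rewrite s_m mem_iota /=; lia.
  by exists v; rewrite ?s_m ?mem_iota /=; lia.
by congr g; case: ifP => _; rewrite /bump; lia.
Qed.

Lemma sum_sub (F : nat -> rat) (a b : nat) : (a <= b)%N ->
  \sum_(a <= v < b) F (b.+1 - v)%N = \sum_(2 <= j < (b - a).+2) F j.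
Proof.
move=> ab; rewrite big_nat_rev -{1}[a]add0n big_addn [RHS](big_addn 0 _ 2).
rewrite subSS subSS subn0; apply: eq_big_nat => i ib.
by congr F; lia.
Qed.

Lemma new_step_split (m t : nat) (g : nat -> rat) : (t <= m)%N ->
  new_step m g t = \sum_(t <= v < m) g v.+1 + g t.
Proof.
move=> tm; rewrite /new_step big_nat_recr //= ltnn; congr (_ + _).
by apply: eq_big_nat => v /andP [_ ->].
Qed.

Lemma old_step_split (m t : nat) (g : nat -> rat) : (t <= m)%N ->
  old_step m.+1 g t = \sum_(t.-1 <= v < m) g v.+1 + g t.
Proof.
move=> tm; have tm' : (t.-1 <= m)%N by lia.
rewrite /old_step big_nat_recr //= ltnn; congr (_ + _).
by apply: eq_big_nat => v /andP [_ ->].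
Qed.

(** With [l = m.+1 - t], the values [v.+1] give the children 2,...,l, and keeping [t] gives l+1. *)
Lemma new_step_tree (r m t : nat) : (t <= m)%N ->
  new_step m (fun u => tree r (m.+2 - u)) t = tree r.+1 (m.+1 - t).
Proof.
move=> tm; rewrite new_step_split // (sum_sub (tree r) tm) /tree -/tree.
have -> : ((m.+1 - t).+2 = (m - t).+3)%N by lia.
rewrite [RHS]big_nat_recr //=; congr (_ + tree r _); lia.
Qed.

(** With [l = m.+2 - t], the labels for [t > 0] are 2,...,l and l once more. For [t = 0] the
    truncated [t.-1] loses one of the two l, whence the case split in [dupsE]. *)
Lemma old_step_tree (r m t : nat) : (t <= m)%N ->
  old_step m.+1 (fun u => tree r (m.+2 - u)) t =
  tree r.+1 (m - t.-1) + tree r (m.+2 - t).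
Proof.
move=> tm; have tm' : (t.-1 <= m)%N by lia.
by rewrite old_step_split // (sum_sub (tree r) tm').
Qed.

(* Number of ways to prepend [r] letters, exactly one of them a repetition, to an
   avoiding word with [m] letters and [low] equal to [t]. *)
Fixpoint dups (r m t : nat) : rat :=
  if r is r'.+1 then
    new_step m (dups r' m.+1) t + old_step m (fun u => tree r' (m.+1 - u)) t
  else 0.

Arguments dups : simpl never.

Lemma dupsS (r m t : nat) :
  dups r.+1 m t =
  new_step m (dups r m.+1) t + old_step m (fun u => tree r (m.+1 - u)) t.
Proof. by []. Qed.

(** Either the suffix of length [L.+1] already contains the repetition, and the other [r] letters
    are all new, or its letters are distinct. *)
Lemma wsum_dups (L r : nat) :
  wsum (L + r).+1 (L + r) (fun=> 1) =
  wsum L.+1 L (fun t => tree r (L.+1 - t)) + wsum L.+1 L.+1 (dups r L.+1).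
Proof.
elim: r L => [|r IHr] L.
  by rewrite addn0 [X in _ + X]big1 ?addr0.
rewrite addnS -addSn IHr (wsumS L.+1 L) (wsumS L.+1 L.+1) [wsum L.+1 L.+2 _]big1_seq; last first.
  by move=> s; rewrite words_gt.
rewrite add0r addrAC addrC; congr (_ + _).
  apply: eq_big_seq => s /mem_words [_ s_m _]; apply: new_step_tree.
  by have := low_le s_m; lia.
by rewrite addrC -big_split.
Qed.

(** * Solution of the recurrence and final evaluation *)

Lemma tree1 (k : nat) : tree 1 k = k%:R.
Proof.
by elim: k => [|k IHk]; rewrite ?tree0 // treeS IHk -natr1.
Qed.

Lemma dupsE (r m t : nat) : (t <= m)%N ->
  dups r.+1 m.+1 t = if t == 0%N then dup_closed r m.+1 - tree r m.+3
                     else dup_closed r (m.+1 - t).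
Proof.
elim: r m t => [|r IHr] m t tm; rewrite dupsS old_step_tree //.
  rewrite /new_step big1 // add0r tree1 /dup_closed /cbin !bin0 /tree.
  case: eqP => [->|t0]; first by rewrite subn0 -!natr1; ring.
  have -> : (m - t.-1 = m.+1 - t)%N by lia.
  by rewrite -natr1; ring.
rewrite new_step_split; last by lia.
have -> : \sum_(t <= v < m.+1) dups r.+1 m.+2 v.+1 =
          \sum_(t <= v < m.+1) (fun j => dup_closed r j.-1) (m.+2 - v)%N.
  by apply: eq_big_nat => v v_m; rewrite IHr /=; [congr dup_closed|]; lia.
rewrite (@sum_sub (fun j => dup_closed r j.-1)); last by lia.
have -> : (m.+1 - t).+2 = (m - t).+3 by lia.
rewrite big_add1 /= IHr; last by lia.
(* The top summand of this sum is the term in which [low] stays [t]. *)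
have := sum_dup_closed r (m - t).+1; rewrite big_nat_recr //=.
have -> : (m.+1 - t = (m - t).+1)%N by lia.
have -> : (m.+2 - t = (m - t).+2)%N by lia.
case: eqP => [->|t0].
  (* The lost repetition costs [tree r.+1 m.+2] and the branch keeping [t = 0] costs [tree r m.+4];
     together they make [tree r.+1 m.+3]. *)
  rewrite !subn0; have := treeS r.+1 m; have := treeS r m.+2; lra.
have -> : (m - t.-1 = (m - t).+1)%N by lia.
lra.
Qed.

Lemma dups_1_0 (p : nat) : dups p.+1 1 0 =
  (3 * p.+1 ^ 2 * 'C(2 * p + 2, p.+1))%:R / (p.+2 * p.+3)%:R.
Proof.
have x_ge0 : (0 : rat) <= p%:R by apply: Num.Theory.ler0n.
(* Comparing neighbours in rows [2 * p + 2] and [2 * p + 3] reduces everything to the central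
   binomial [cbin p.+1 0]. *)
have E1 : p.+2%:R * cbin p 2 = p.+1%:R * cbin p.+1 0.
  rewrite /cbin -!natrM; congr (_%:R).
  have -> : (2 * p.+1 + 0 = 2 * p + 2)%N by lia.
  have := mul_bin_left (2 * p + 2) p.
  have -> : (2 * p + 2 - p = p.+2)%N by lia.
  by move=> ->.
have E2 : p.+3%:R * cbin p 3 = p.+1%:R * cbin p.+1 1.
  rewrite /cbin -!natrM; congr (_%:R).
  have -> : (2 * p.+1 + 1 = 2 * p + 3)%N by lia.
  have := mul_bin_left (2 * p + 3) p.
  have -> : (2 * p + 3 - p = p.+3)%N by lia.
  by move=> ->.
rewrite !natrM.
have -> : 'C(2 * p + 2, p.+1)%:R = cbin p.+1 0.
  by rewrite /cbin; congr ('C(_, _)%:R); lia.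
have := treeS p 1; have := treeS p 0; have := treeE p 0; have := treeE p 1.
rewrite dupsE // eqxx /dup_closed tree0 add0r => -> -> <-.
have := cbinS p 0; have := cbinS0 p.
have x2 : p%:R + 2 != 0 :> rat by lra.
have x3 : p%:R + 3 != 0 :> rat by lra.
move: E1 E2.
have -> : p.+3%:R = p%:R + 3 :> rat by rewrite -(natrD _ p 3) addn3.
have -> : p.+2%:R = p%:R + 2 :> rat by rewrite -(natrD _ p 2) addn2.
have -> : p.+1%:R = p%:R + 1 :> rat by rewrite natr1.
move: (p%:R : rat) x2 x3 => x x2 x3 E1 E2 E3 E4.
have c2E : cbin p 2 = (x + 1) * cbin p.+1 0 / (x + 2).
  by rewrite -E1; field.
have c3E : cbin p 3 = (x + 1) * (cbin p.+1 0 + cbin p 2) / (x + 3).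
  by rewrite -E4 -E2; field.
have c1E : cbin p 1 = cbin p.+1 0 / 2 by rewrite E3; field.
move=> E5; have -> : tree p 3 = 2 * cbin p 2 - cbin p 3 by lra.
by rewrite c3E c1E c2E; field; rewrite x2 x3.
Qed.

Theorem theorem4 (n : nat) (hn : (1 <= n)%N) :
  ((op n n.-1 pat123)%:R : rat)%R =
    ((3 * (n.-1) ^ 2 * 'C(2 * n - 2, n.-1))%:R / (n * n.+1)%:R)%R.
Proof.
case: n hn => // r _; rewrite op_words succnK.
have -> : (size (words r.+1 r))%:R = wsum r.+1 r (fun=> 1) :> rat.
  by rewrite /wsum big_const_seq count_predT iter_addr_0.
(* Growth starts from a single letter: the only word is [[:: 0]], with [low] equal to 0. *)
rewrite (wsum_dups 0 r) [wsum 1 0 _]big_nil add0r.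
rewrite [wsum 1 1 _]big_seq1 [low _]/=.
case: r => [|p]; first by rewrite mul0r.
rewrite dups_1_0; congr ((_ * 'C(_, _))%:R / _); lia.
Qed.
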